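(* For any integers $d\ge 2$, $k\ge 1$ and any $\gamma>0$ there exists $n_0$ such that for all $n\ge n_0$, \[M_k(d,n)\le \left(1-\frac1{N_k(d)}+\gamma\right)\frac{n^2}{2}.\] Moreover, there is a constant $c=c(k,d,\gamma)>0$ such that the same bound remains valid if in the definition of $M_k(d,n)$ the intervals $[t_i,t_i+1]$ are replaced by the intervals $[t_i,t_i+cn^{1/d}]$.
   Context: A set $P\subseteq\mathbb{R}^d$ is separated if $\|p_1-p_2\|\ge 1$ for all distinct $p_1,p_2\in P$. $M_k(d,n)$ is the largest $M$ for which there exist a separated set $S\subseteq\mathbb{R}^d$ of $n$ points and reals $1\le t_1\le\dots\le t_k$ such that at least $M$ pairs $\{p_1,p_2\}\subseteq S$ satisfy $\|p_1-p_2\|\in\bigcup_{i=1}^k[t_i,t_i+1]$. For $\varepsilon>0$, a separated set $P$ is an $\varepsilon$-nearly $k$-distance set (with distances $1\le t_1<\dots<t_k$) if $\|p_1-p_2\|\in\bigcup_{i=1}^k[t_i,t_i+\varepsilon]$ for all distinct $p_1,p_2\in P$. The angle between a vector $v$ and an affine subspace (plane) $\Lambda$ is the infimum of the angles between $v$ and vectors $w\in\Lambda-\Lambda$. A set $P\subseteq\mathbb{R}^d$ is $(p,d-1,\alpha)$-flat with respect to a hyperplane $\Lambda_p$ if every vector $p-q$, $q\in P$, makes angle at most $\alpha$ with $\Lambda_p$; $P$ is $(d-1,\alpha)$-flat if for every $p\in P$ it is $(p,d-1,\alpha)$-flat with respect to some hyperplane $\Lambda_p$. $N_k(d)$ is the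 largest $N$ such that for every $\varepsilon,\alpha>0$ there exists a $(d-1,\alpha)$-flat $\varepsilon$-nearly $k$-distance set in $\mathbb{R}^d$ of cardinality $N$. *)

(* Defs.v *)
From HB Require Import structures.
From mathcomp Require Import all_boot all_order all_algebra.
From mathcomp Require Import all_classical all_reals all_analysis.
From mathcomp Require Import Rstruct Rstruct_topology.
Set Implicit Arguments. Unset Strict Implicit. Unset Printing Implicit Defensive.
Import Order.TTheory GRing.Theory Num.Theory.
Local Open Scope classical_set_scope.
Local Open Scope ring_scope.

Notation R := Rdefinitions.R.

Definition dotp (d : nat) (x y : 'rV[R]_d) : R := \sum_(i < d) x ord0 i * y ord0 i.
Definition enorm (d : nat) (x : 'rV[R]_d) : R := Num.sqrt (dotp x x).
Definition edist (d : nat) (x y : 'rV[R]_d) : R := enorm (x - y).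

(* A finite point set of cardinality n is given by an indexing p : 'I_n -> R^d.
   Separated: distinct points are at distance >= 1 (this forces injectivity). *)
Definition separated (d n : nat) (p : 'I_n -> 'rV[R]_d) : Prop :=
  forall i j : 'I_n, i != j -> 1 <= edist (p i) (p j).

Definition count_pairs (d n k : nat) (p : 'I_n -> 'rV[R]_d) (t : 'I_k -> R)
  (w : R) : nat :=
  #|[set ab : 'I_n * 'I_n | (ab.1 < ab.2)%N &&
     [exists i : 'I_k, (t i <= edist (p ab.1) (p ab.2))
                        && (edist (p ab.1) (p ab.2) <= t i + w)]]|.

Definition admissible_t (k : nat) (t : 'I_k -> R) : Prop :=
  (forall i, 1 <= t i) /\ (forall i j : 'I_k, (i <= j)%N -> t i <= t j).

Definition M_attained (d k n : nat) (w : R) (M : nat) : Prop :=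
  exists (p : 'I_n -> 'rV[R]_d) (t : 'I_k -> R),
    separated p /\ admissible_t t /\ (M <= count_pairs p t w)%N.

Definition vangle (d : nat) (v w : 'rV[R]_d) : R :=
  acos (dotp v w / (enorm v * enorm w)).

Definition hyperplane (d : nat) (L : set 'rV[R]_d) : Prop :=
  exists (u : 'rV[R]_d) (b : R), u != 0 /\ L = [set x | dotp u x = b].

Definition diffset (d : nat) (L : set 'rV[R]_d) : set 'rV[R]_d :=
  [set w | exists a b, L a /\ L b /\ w = a - b].

Definition angle_plane (d : nat) (v : 'rV[R]_d) (L : set 'rV[R]_d) : R :=
  inf [set vangle v w | w in [set w | diffset L w /\ w != 0]].

(* (d-1, alpha)-flat (vectors p - q with q = p are ignored, their angle being
   undefined) *)
Definition flat (d n : nat) (alpha : R) (p : 'I_n -> 'rV[R]_d) : Prop :=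
  forall a : 'I_n, exists L : set 'rV[R]_d, hyperplane L /\
    forall b : 'I_n, b != a -> angle_plane (p a - p b) L <= alpha.

Definition nearly_kdist (d n k : nat) (eps : R) (p : 'I_n -> 'rV[R]_d) : Prop :=
  separated p /\
  exists t : 'I_k -> R,
    (forall i, 1 <= t i) /\ (forall i j : 'I_k, (i < j)%N -> t i < t j) /\
    forall a b : 'I_n, a != b ->
      exists i : 'I_k, t i <= edist (p a) (p b) <= t i + eps.

Definition N_prop (d k N : nat) : Prop :=
  forall eps alpha : R, 0 < eps -> 0 < alpha ->
    exists p : 'I_N -> 'rV[R]_d, flat alpha p /\ nearly_kdist k eps p.

Definition is_Nk (d k N : nat) : Prop :=
  N_prop d k N /\ forall N', N_prop d k N' -> (N' <= N)%N.

(* Main.v *)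
Require Import Defs.
From HB Require Import structures.
From mathcomp Require Import all_boot all_order all_algebra.
From mathcomp Require Import all_classical all_reals all_analysis.
From mathcomp Require Import Rstruct Rstruct_topology.
From mathcomp Require Import ring lra.
Import Order.TTheory GRing.Theory Num.Theory.
(* Defs is imported again because mathcomp-analysis has its own [edist]. *)
Import Defs.
Local Open Scope ring_scope.
Set Implicit Arguments. Unset Strict Implicit. Unset Printing Implicit Defensive.

(** Let w be the width of the bands and K a large constant. Join two points when
    their distance lies in a band and is at least K w. By packing, only a small fraction
    of the pairs is shorter than K w when w <= c n^(1/d) with c small, so if the bound
    fails then the Moon-Moser inequalities give many (N+1)-cliques, in the strong sense
    that the average N-clique L extends by a positive proportion of the points.

    Call v, adjacent to all of L, unpaired if no v' has |v v'| >= K w,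
    K |v v'| <= |v u| and ||v u| - |v' u|| <= w for all u in L. Sort the unpaired v by the
    bands containing their distances to L. If t is the lowest of these bands, a
    class lies in a ball of radius 2t, which splits into boundedly many cells of
    diameter less than t/K. Two members of a class in one cell are less than K w
    apart, so a cell contains few of them. Hence unpaired vertices are negligible,
    and some (N+1)-clique has a partner v' for each of its vertices v.
    Comparing |v u| with |v' u| shows that v - v' is almost orthogonal to all v - u,
    so the clique, rescaled by eps / w, is flat and eps-nearly k-distance; this contradicts
    the maximality of N. *)

(** * Cliques *)

Local Close Scope ring_scope.

Section Cliques.
Variables (T : finType) (adj : rel T).
Hypotheses (adj_sym : symmetric adj) (adj_irr : irreflexive adj).

Definition cliques (s : nat) : {set {set T}} :=
  [set K : {set T} | (#|K| == s) && [forall x in K, forall y in K, (x != y) ==> adj x y]].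

Definition nbrs (L : {set T}) : {set T} := [set w | [forall u in L, adj w u]].

Lemma cliquesP s (K : {set T}) :
  reflect (#|K| = s /\ {in K &, forall x y, x != y -> adj x y}) (K \in cliques s).
Proof.
rewrite inE; apply: (iffP andP) => [[/eqP cK H]|[cK H]]; split=> //.
- move=> x y xK yK; apply/implyP.
  by move/forall_inP/(_ x xK)/forall_inP/(_ y yK): H.
- exact/eqP.
by apply/forall_inP => x xK; apply/forall_inP => y yK; apply/implyP/H.
Qed.

Lemma nbrsP (L : {set T}) w : reflect {in L, forall u, adj w u} (w \in nbrs L).
Proof. by rewrite inE; exact: forall_inP. Qed.

Lemma nbrs_notin (L : {set T}) w : w \in nbrs L -> w \notin L.
Proof. by move=> /nbrsP H; apply/negP => /H; rewrite adj_irr. Qed.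

(** Double counting: [(K, v)] corresponds to [(K :\ v, v)], with inverse [(L, w)] to [(w |: L, w)],
    since adding a common neighbour to a clique gives a clique. *)
Lemma cliques_split s (F : {set T} -> T -> nat) :
  \sum_(K in cliques s.+1) \sum_(v in K) F (K :\ v) v =
  \sum_(L in cliques s) \sum_(w in nbrs L) F L w.
Proof.
rewrite !pair_big_dep /=.
rewrite (reindex_onto (fun q => (q.2 |: q.1, q.2))
                      (fun q => (q.1 :\ q.2, q.2))) /=; last first.
  by case=> K v /= /andP[_ vK]; rewrite finset.setD1K.
apply: eq_big => [[L w]|[L w]] /=; last first.
  case/andP => _ /eqP[->] //.
rewrite xpair_eqE eqxx andbT finset.setU11 andbT.
apply/andP/andP => [[/cliquesP[cK aK] /eqP eL]|[/cliquesP[cL aL] wL]].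
  have wL : w \notin L by rewrite -eL !inE eqxx.
  split.
    apply/cliquesP; split.
      by move: cK; rewrite cardsU1 wL add1n => -[].
    by move=> x y xL yL; apply: aK; rewrite !inE ?xL ?yL orbT.
  apply/nbrsP => u uL; apply: aK; rewrite ?inE ?eqxx ?uL ?orbT //.
  by apply: contraNneq wL => ->.
have wnL := nbrs_notin wL; split; last first.
  by rewrite finset.setU1K.
apply/cliquesP; split; first by rewrite cardsU1 wnL cL.
move=> x y; rewrite !inE => /orP[/eqP->|xL] /orP[/eqP->|yL]; rewrite ?eqxx // => xy.
- exact: (nbrsP _ _ wL).
- by rewrite adj_sym; exact: (nbrsP _ _ wL).
- exact: aL.
Qed.

Lemma sum_nbrs s : \sum_(L in cliques s) #|nbrs L| = s.+1 * #|cliques s.+1|.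
Proof.
transitivity (\sum_(L in cliques s) \sum_(w in nbrs L) 1).
  by apply: eq_bigr => L _; rewrite sum1_card.
rewrite -(cliques_split s (fun _ _ => 1)) -sum1_card big_distrr /=.
by apply: eq_bigr => K /cliquesP[cK _]; rewrite sum1_card cK muln1.
Qed.

(** A common neighbour of [K] is counted [s.+1] times. Any other [w] misses some [u] in [K], so only
    the summand [v = u] can count it, at most once. *)
Lemma sum_nbrsD1 s (K : {set T}) : K \in cliques s.+1 ->
  \sum_(v in K) #|nbrs (K :\ v)| <= #|T| + s * #|nbrs K|.
Proof.
move=> /cliquesP[cK _].
have cardE (A : {set T}) : #|A| = \sum_(w : T) (w \in A).
  by rewrite -sum1_card big_mkcond; apply: eq_bigr => w _; case: (w \in A).
under eq_bigr do rewrite cardE.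
rewrite exchange_big (cardE (nbrs K)) big_distrr /=.
have -> : #|T| = \sum_(w : T) 1 by rewrite -sum1_card; apply: eq_bigl.
rewrite -big_split /=.
apply: leq_sum => w _.
have [wK|wNK] := boolP (w \in nbrs K).
  rewrite muln1 add1n -cK -sum1_card; apply: leq_sum => v vK; exact: leq_b1.
rewrite muln0 addn0.
have [u uK uw] : exists2 u, u \in K & ~~ adj w u.
  by move: wNK; rewrite inE => /forall_inPn.
rewrite (bigD1 u) //= big1 ?addn0 ?leq_b1 // => v /andP[vK vu].
apply/eqP; rewrite eqb0; apply/negP => /nbrsP /(_ u).
by rewrite !inE eq_sym vu uK (negPf uw) => /(_ isT).
Qed.

Lemma sum_sqr_cauchy (I : finType) (A : {set I}) (a : I -> nat) :
  (\sum_(i in A) a i) ^ 2 <= #|A| * \sum_(i in A) a i ^ 2.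
Proof.
rewrite -(leq_pmul2l (isT : 0 < 2)) -mulnn big_distrl /= big_distrr /=.
have -> : 2 * (#|A| * \sum_(i in A) a i ^ 2) =
    \sum_(i in A) \sum_(j in A) (a i ^ 2 + a j ^ 2).
  under [RHS]eq_bigr do rewrite big_split /= sum_nat_const.
  by rewrite big_split /= sum_nat_const -big_distrr /= mul2n addnn.
apply: leq_sum => i _; rewrite !big_distrr /=; apply: leq_sum => j _.
by rewrite nat_Cauchy.
Qed.

(* Count pairs (K, w) with w adjacent to K minus a point, then apply Cauchy-Schwarz
   to the degrees of the s-cliques. *)
Lemma moon_moser s :
  (s.+1 * #|cliques s.+1|) ^ 2 <=
  #|cliques s| * (#|T| * #|cliques s.+1| + s * (s.+2 * #|cliques s.+2|)).
Proof.
rewrite -!sum_nbrs; apply: leq_trans (sum_sqr_cauchy _ _) _.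
rewrite leq_mul2l; apply/orP; right.
have -> : \sum_(L in cliques s) #|nbrs L| ^ 2 =
    \sum_(L in cliques s) \sum_(w in nbrs L) #|nbrs L|.
  by apply: eq_bigr => L _; rewrite sum_nat_const mulnn.
rewrite -(cliques_split s (fun L _ => #|nbrs L|)) [#|T| * _]mulnC -sum_nat_const.
rewrite big_distrr -big_split /=; apply: leq_sum => K; exact: sum_nbrsD1.
Qed.

Lemma cliques0E : cliques 0 = [set finset.set0].
Proof.
apply/setP => K; rewrite finset.in_set1; apply/cliquesP/eqP => [[/eqP]|->].
  by rewrite cards_eq0 => /eqP.
by split=> [|x y]; rewrite ?cards0 // inE.
Qed.

Lemma card_cliques1 : #|cliques 1| = #|T|.
Proof.
have := sum_nbrs 0; rewrite mul1n => <-; rewrite cliques0E big_set1.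
by apply: eq_card => w; apply/nbrsP => u; rewrite inE.
Qed.

Lemma card_cliques2 : 2 * #|cliques 2| = #|[set e : T * T | adj e.1 e.2]|.
Proof.
have c1 : cliques 1 = [set [set x] | x in T].
  apply/setP => K; apply/cliquesP/imsetP => [[/eqP/cards1P[x ->]]|[x _ ->]].
    by exists x.
  split=> [|y z]; first exact: cards1.
  by rewrite !inE => /eqP-> /eqP->; rewrite eqxx.
rewrite -sum_nbrs c1 big_imset /=; last by move=> x y _ _ /set1_inj.
rewrite -sum1dep_card -(pair_big_dep xpredT adj (fun _ _ => 1)) /=.
apply: eq_bigr => x _; rewrite sum1_card; apply: eq_card => w.
apply/nbrsP/idP => [H|xw u]; last by rewrite inE => /eqP->; rewrite adj_sym.
by rewrite -[_ \in _]/(adj x w) adj_sym; apply: H; rewrite inE.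
Qed.

Local Open Scope ring_scope.

(** Let r_s be the ratio of [s.+1 * #|cliques s.+1|] to [#|T| * #|cliques s|]. Moon-Moser reads
    (s+1) r_s <= 1 + s r_(s+1), so r_s >= 1 - s x passes from s to s+1 for s >= 1. The density
    hypothesis is the case s = 1. *)
Lemma clique_ratio (F : realFieldType) (x : F) (s : nat) :
  (0 < #|T|)%N -> s%:R * x < 1 ->
  (1 - x) * #|T|%:R ^+ 2 <= (2 * #|cliques 2|)%:R ->
  (0 < #|cliques s|)%N /\
  (1 - s%:R * x) * #|T|%:R * #|cliques s|%:R <= (s.+1 * #|cliques s.+1|)%:R.
Proof.
move=> T0 + dens; elim: s => [_|[_ x1|s IH xs]].
- by rewrite cliques0E cards1 card_cliques1 mul0r subr0 mul1r mulr1 mul1n.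
- rewrite card_cliques1 T0; split=> //; apply: le_trans dens.
  by rewrite mul1r -mulrA expr2.
have T0' : 0 < #|T|%:R :> F by rewrite ltr0n.
(* The sign of [x] is not known: it will be 1/N - g with an arbitrary g > 0. *)
have x1 : s.+1%:R * x < 1.
  have [x0|x0] := ltP x 0; first by rewrite (lt_trans _ ltr01) // pmulr_rlt0.
  by apply: le_lt_trans xs; rewrite ler_wpM2r // ler_nat.
have [ks0 IHs] := IH x1.
have ks0' : 0 < #|cliques s.+1|%:R :> F by rewrite ltr0n.
have ks1 : 0 < (s.+2 * #|cliques s.+2|)%:R :> F.
  apply: lt_le_trans IHs; rewrite !mulr_gt0 // subr_gt0 //.
split; first by move: ks1; rewrite ltr0n muln_gt0.
have := moon_moser s.+1.
rewrite -(ler_nat F) !(natrX, natrM, natrD).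
move: IHs ks1 xs x1; rewrite !natrM.
set K := #|cliques s.+3|%:R; set K2 := #|cliques s.+2|%:R.
set K1 := #|cliques s.+1|%:R; rewrite -/K1 in ks0'.
set n := #|T|%:R; rewrite -/n in T0'.
rewrite -[s.+3]addn1 -[s.+2]addn1 -[s.+1]addn1 !natrD.
set S := s%:R => IHs ks1 xs x1 mm.
have S0 : 0 <= S by rewrite ler0n.
move: T0' ks0' IHs ks1 xs x1 mm S0; move: S K K1 K2 n => S K K1 K2 n.
move=> _ K10 IHs ks1 _ _ mm S0.
(* With this factor the goal becomes the same polynomial inequality as Moon-Moser combined with the
   induction hypothesis. *)
rewrite -(ler_pM2l (_ : 0 < (S + 1) * K1)); last by rewrite mulr_gt0 // ltr_wpDl.
have := le_trans (ler_wpM2l (ltW ks1) IHs) mm.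
rewrite -subr_ge0 => h; rewrite -subr_ge0.
by move: h; congr (_ <= _); ring.
Qed.

(** For x = 1/N - g, [clique_ratio] leaves 1 - N x = N g, so N-cliques have at least N g n common
    neighbours on average. If each (N+1)-clique [K] had a bad [v], charging [K] to [K :\ v] would
    give at most D of them per N-clique, which is too few. *)
Lemma clique_avoiding (F : realFieldType) (N : nat) (g D : F)
  (bad : {set T} -> {set T}) :
  (0 < #|T|)%N -> (0 < N)%N -> 0 < g ->
  (1 - N%:R^-1 + g) * #|T|%:R ^+ 2 <= #|[set e : T * T | adj e.1 e.2]|%:R ->
  {in cliques N, forall L, bad L \subset nbrs L /\ #|bad L|%:R <= D} ->
  N.+1%:R * D < N%:R * g * #|T|%:R ->
  exists2 K, K \in cliques N.+1 & {in K, forall v, v \notin bad (K :\ v)}.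
Proof.
move=> T0 N0 g0 dens hbad hD; rewrite -card_cliques2 in dens.
have N0' : 0 < N%:R :> F by rewrite ltr0n.
have eN : N%:R * (N%:R^-1 - g) = 1 - N%:R * g by field; rewrite gt_eqF.
have [||k0 ratio] := @clique_ratio F (N%:R^-1 - g) N T0.
- by rewrite eN gtrBl mulr_gt0.
- by apply: le_trans dens; rewrite opprB [g - _]addrC addrA.
have [/exists_inP[K KN /forall_inP KP]|] :=
  boolP [exists K in cliques N.+1, [forall v in K, v \notin bad (K :\ v)]].
  by exists K.
rewrite negb_exists_in => /forall_inP H; exfalso.
have : (#|cliques N.+1| <= (\sum_(L in cliques N) #|bad L|)%N)%N.
  have -> : (\sum_(L in cliques N) #|bad L| =
      \sum_(L in cliques N) \sum_(w in nbrs L) (w \in bad L))%N.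
    apply: eq_bigr => L /hbad[/fintype.subsetP bN _].
    rewrite -sum1_card big_mkcond [RHS]big_mkcond; apply: eq_bigr => w _ /=.
    by case: ifPn => [/bN ->|]; [|case: ifP].
  rewrite -(cliques_split N (fun L w => nat_of_bool (w \in bad L))) -sum1_card.
  apply: leq_sum => K /H; rewrite negb_forall_in => /exists_inP[v vK].
  by rewrite negbK => vb; rewrite (bigD1 v) //= vb.
rewrite -(ler_nat F) natr_sum => le_k.
have {}le_k : #|cliques N.+1|%:R <= #|cliques N|%:R * D.
  apply: le_trans le_k _; rewrite mulr_natl -sumr_const.
  by apply: ler_sum => L /hbad[].
have : N.+1%:R * (#|cliques N|%:R * D) < (1 - (1 - N%:R * g)) * #|T|%:R * #|cliques N|%:R.
  have := hD; rewrite -(ltr_pM2l (_ : 0 < #|cliques N|%:R)) ?ltr0n // => h.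
  apply: le_lt_trans (lt_le_trans h _).
    by rewrite le_eqVlt; apply/orP; left; apply/eqP; ring.
  by rewrite le_eqVlt; apply/orP; left; apply/eqP; ring.
rewrite -eN => /lt_le_trans/(_ ratio); rewrite natrM ltNge ler_wpM2l ?ler0n //.
Qed.

End Cliques.

Local Open Scope ring_scope.

(** * Euclidean geometry and packing *)

Section Euclid.
Variable d : nat.
Implicit Types x y z : 'rV[R]_d.

Lemma dotpC x y : dotp x y = dotp y x.
Proof. by apply: eq_bigr => i _; rewrite mulrC. Qed.

Lemma dotpDl x y z : dotp (x + y) z = dotp x z + dotp y z.
Proof. by rewrite -big_split; apply: eq_bigr => i _; rewrite mxE mulrDl. Qed.

Lemma dotpZl (a : R) x z : dotp (a *: x) z = a * dotp x z.
Proof. by rewrite /dotp mulr_sumr; apply: eq_bigr => i _; rewrite mxE mulrA. Qed.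

Lemma dotpNl x z : dotp (- x) z = - dotp x z.
Proof. by rewrite -scaleN1r dotpZl mulN1r. Qed.

Lemma dotpDr x y z : dotp z (x + y) = dotp z x + dotp z y.
Proof. by rewrite dotpC dotpDl !(dotpC z). Qed.

Lemma dotpZr (a : R) x z : dotp z (a *: x) = a * dotp z x.
Proof. by rewrite dotpC dotpZl dotpC. Qed.

Lemma dotpNr x z : dotp z (- x) = - dotp z x.
Proof. by rewrite dotpC dotpNl dotpC. Qed.

Definition dotpE := (dotpDl, dotpDr, dotpZl, dotpZr, dotpNl, dotpNr).

Lemma dotp_ge0 x : 0 <= dotp x x.
Proof. by apply: sumr_ge0 => i _; rewrite -expr2 sqr_ge0. Qed.

Lemma dotp_eq0 x : (dotp x x == 0) = (x == 0).
Proof.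
apply/eqP/eqP => [/eqP|->]; last by rewrite /dotp big1 // => i _; rewrite mxE mul0r.
rewrite psumr_eq0 => [/allP x0|i _]; last by rewrite -expr2 sqr_ge0.
apply/rowP => i; rewrite mxE; apply/eqP; rewrite -sqrf_eq0 expr2.
exact: (x0 i (mem_index_enum i)).
Qed.

Lemma enorm_ge0 x : 0 <= enorm x. Proof. exact: sqrtr_ge0. Qed.

Lemma enorm_sqr x : enorm x ^+ 2 = dotp x x.
Proof. by rewrite sqr_sqrtr ?dotp_ge0. Qed.

Lemma enorm_gt0 x : (0 < enorm x) = (x != 0).
Proof. by rewrite sqrtr_gt0 lt_def dotp_ge0 dotp_eq0 andbT. Qed.

Lemma enormZ (a : R) x : 0 <= a -> enorm (a *: x) = a * enorm x.
Proof.
by move=> a0; rewrite /enorm !dotpE mulrA -expr2 sqrtrM ?sqr_ge0 // sqrtr_sqr ger0_norm.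
Qed.

Lemma enormN x : enorm (- x) = enorm x.
Proof. by rewrite /enorm !dotpE opprK. Qed.

Lemma cauchy_schwarz x y : `|dotp x y| <= enorm x * enorm y.
Proof.
rewrite -(@ler_pXn2r _ 2) ?nnegrE ?normr_ge0 ?mulr_ge0 ?enorm_ge0 //.
rewrite exprMn !enorm_sqr real_normK ?num_real //.
have [->|y0] := eqVneq y 0.
  by rewrite -(scale0r 0) !dotpE !mul0r mulr0 expr0n.
have yy0 : 0 < dotp y y by rewrite lt_def dotp_ge0 dotp_eq0 y0.
have := dotp_ge0 (dotp y y *: x - dotp x y *: y).
rewrite !dotpE (dotpC y x).
set a := dotp y y in yy0 *; set b := dotp x y; set c := dotp x x.
move=> h; have : 0 <= a * (c * a - b ^+ 2) by move: h; congr (_ <= _); ring.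
by rewrite pmulr_rge0 // subr_ge0.
Qed.

Lemma edistxx x : edist x x = 0.
Proof. by rewrite /edist subrr; apply/eqP; rewrite -sqrf_eq0 enorm_sqr dotp_eq0. Qed.

Lemma edistC x y : edist x y = edist y x.
Proof. by rewrite /edist -enormN opprB. Qed.

Lemma edistZ (a : R) x y : 0 <= a -> edist (a *: x) (a *: y) = a * edist x y.
Proof. by move=> a0; rewrite /edist -scalerBr enormZ. Qed.

Lemma coord_le_enorm x i : `|x ord0 i| <= enorm x.
Proof.
rewrite -(@ler_pXn2r _ 2) ?nnegrE ?enorm_ge0 ?normr_ge0 //.
rewrite enorm_sqr real_normK ?num_real // /dotp (bigD1 i) //= -expr2 lerDl.
by apply: sumr_ge0 => j _; rewrite -expr2 sqr_ge0.
Qed.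

Lemma enorm_lt_coord x (h : R) : (0 < d)%N ->
  (forall i, `|x ord0 i| < h) -> enorm x < d%:R * h.
Proof.
move=> d0 xh; have h0 : 0 < h by apply: le_lt_trans (xh (Ordinal d0)).
have d1 : 1 <= d%:R :> R by rewrite ler1n.
rewrite -(@ltr_pXn2r _ 2) ?nnegrE ?enorm_ge0 ?mulr_ge0 ?ler0n ?ltW // enorm_sqr.
apply: (@lt_le_trans _ _ (\sum_(i < d) h ^+ 2)).
  apply: ltr_sum => [|i _]; first by apply/hasP; exists (Ordinal d0).
  by rewrite -expr2 -real_normK ?num_real // ltrXn2r.
rewrite sumr_const card_ord exprMn -[leLHS]mulr_natl ler_wpM2r ?sqr_ge0 //.
by rewrite expr2 ler_peMr // ler0n.
Qed.

Lemma card_fibers (I J : finType) (f : I -> J) (A : {set I}) (m : nat) :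
  (forall j, (#|[set a in A | f a == j]| <= m)%N) -> (#|A| <= #|J| * m)%N.
Proof.
move=> fm; rewrite -sum1_card (partition_big f xpredT) //= -sum_nat_const.
apply: leq_sum => j _; rewrite sum1dep_card; apply: leq_trans (fm j).
by apply: eq_leq; apply: eq_card => a; rewrite !inE.
Qed.

(* Cut the ball into a grid of cells of diameter less than s. *)
Lemma card_ball_le (I : finType) (p : I -> 'rV[R]_d) (S : {set I}) y (r s : R)
  (m : nat) : (0 < d)%N -> 0 < s -> 0 <= r ->
  {in S, forall a, edist (p a) y <= r} ->
  (forall T : {set I}, T \subset S ->
     {in T &, forall a b, edist (p a) (p b) < s} -> (#|T| <= m)%N) ->
  (#|S| <= (Num.truncn (2 * d%:R * r / s)).+1 ^ d * m)%N.
Proof.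
move=> d0 s0 r0 Sr Sm.
have dR0 : 0 < d%:R :> R by rewrite ltr0n.
(* Coordinates in units of s/d, the side for which [enorm_lt_coord] gives diameter less than s. The
   shift by r makes them nonnegative on [S], so that truncation is the floor. *)
pose u a i := d%:R / s * (p a ord0 i - y ord0 i + r).
have u0 a i : a \in S -> 0 <= u a i.
  move=> /Sr; rewrite /edist => Sa; apply: mulr_ge0; first by rewrite divr_ge0 ?ltW.
  have := le_trans (coord_le_enorm (p a - y) i) Sa; rewrite !mxE ler_norml; lra.
pose cell a := [ffun i : 'I_d =>
  inord (Num.truncn (u a i)) : 'I_(Num.truncn (2 * d%:R * r / s)).+1].
have -> : ((Num.truncn (2 * d%:R * r / s)).+1 ^ d =
    #|{ffun 'I_d -> 'I_(Num.truncn (2 * d%:R * r / s)).+1}|)%N.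
  by rewrite card_ffun !card_ord.
have cellE a i : a \in S -> cell a i = Num.truncn (u a i) :> nat.
  move=> aS; rewrite ffunE inordK // ltnS; apply: le_truncn.
  have -> : 2 * d%:R * r / s = d%:R / s * (2 * r) by ring.
  apply: ler_wpM2l; first by rewrite divr_ge0 ?ltW.
  have := le_trans (coord_le_enorm (p a - y) i) (Sr _ aS); rewrite !mxE ler_norml; lra.
apply: (@card_fibers _ _ cell) => c; apply: Sm.
  by apply/fintype.subsetP => a; rewrite inE => /andP[].
move=> a b; rewrite !inE => /andP[aS /eqP ac] /andP[bS /eqP bc].
have -> : s = d%:R * (s / d%:R) by rewrite mulrC divfK ?gt_eqF.
apply: enorm_lt_coord => // i.
have ab : Num.truncn (u a i) = Num.truncn (u b i).
  by rewrite -!cellE // ac bc.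
have /andP[a1 a2] := truncn_itv (u0 a i aS).
have /andP[b1 b2] := truncn_itv (u0 b i bS).
rewrite ab -natr1 in a1 a2; rewrite -natr1 in b2.
have -> : (p a - p b) ord0 i = s / d%:R * (u a i - u b i).
  by rewrite !mxE /u; field; rewrite !gt_eqF.
rewrite normrM gtr0_norm ?divr_gt0 // -[ltRHS]mulr1 ltr_pM2l ?divr_gt0 //.
by rewrite ltr_norml; lra.
Qed.

(* The angle is attained at the orthogonal projection of e to the hyperplane. *)
Lemma angle_plane_le (e z : 'rV[R]_d) (al sg : R) : z != 0 -> e != 0 ->
  0 <= sg < 1 -> 0 <= al <= pi -> cos al <= 1 - sg ^+ 2 ->
  `|dotp e z| <= sg * (enorm e * enorm z) ->
  angle_plane e [set x | dotp z x = 0]%classic <= al.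
Proof.
move=> z0 e0 /andP[sg0 sg1] alpi cal ez.
have ne : 0 < enorm e by rewrite enorm_gt0.
have nz : 0 < enorm z by rewrite enorm_gt0.
have zz : 0 < dotp z z by rewrite -enorm_sqr exprn_gt0.
have ee : 0 < dotp e e by rewrite -enorm_sqr exprn_gt0.
pose x := e - (dotp e z / dotp z z) *: z.
have zx : dotp z x = 0.
  by rewrite !dotpE (dotpC z e) divfK ?subrr ?gt_eqF.
have ex : dotp e x = dotp x x.
  by rewrite {2}/x dotpDl dotpNl dotpZl zx mulr0 oppr0 addr0.
have xxE : dotp x x = dotp e e - dotp e z ^+ 2 / dotp z z.
  by rewrite -ex !dotpE; ring.
have xx_ge : (1 - sg ^+ 2) * dotp e e <= dotp x x.
  rewrite xxE mulrBl mul1r lerB // ler_pdivrMr //.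
  rewrite -real_normK ?num_real // -!enorm_sqr.
  have := ez; rewrite -(@ler_pXn2r _ 2) ?nnegrE ?mulr_ge0 ?normr_ge0 ?enorm_ge0 //.
  by rewrite !exprMn mulrA.
have sg2 : 0 < 1 - sg ^+ 2 by rewrite subr_gt0 expr_lt1.
have xx0 : 0 < dotp x x by apply: lt_le_trans xx_ge; rewrite mulr_gt0.
have x0 : x != 0 by rewrite -dotp_eq0 gt_eqF.
have nx : 0 < enorm x by rewrite enorm_gt0.
have acos_rng (v w : 'rV[R]_d) : -1 <= dotp v w / (enorm v * enorm w) <= 1.
  have [->|vw] := eqVneq (enorm v * enorm w) 0.
    by rewrite invr0 mulr0 lerN10 ler01.
  have vw0 : 0 < enorm v * enorm w by rewrite lt_def vw mulr_ge0 ?enorm_ge0.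
  by rewrite -ler_norml normrM normfV (gtr0_norm vw0) ler_pdivrMr // mul1r cauchy_schwarz.
apply: (@le_trans _ _ (vangle e x)).
  apply: ge_inf; first by exists 0 => _ [w _ <-]; exact: acos_ge0.
  exists x => //; split=> //=; exists x, 0; split=> //.
  by split; rewrite ?subr0 //= -(scale0r 0) dotpZr mul0r.
have [/andP[ge0 lepi] cosE] := acos_def (acos_rng e x).
have in_pi (a : R) : 0 <= a <= pi -> a \in `[0, pi]%R by rewrite in_itv.
rewrite leNgt -(ltr_cos (in_pi _ alpi)) ?in_pi ?ge0 // cosE -leNgt.
apply: le_trans cal _; rewrite ler_pdivlMr ?mulr_gt0 // ex.
(* The cosine is |x|/|e|. As |x| <= |e|, it is at least |x|^2/|e|^2 >= 1 - sg^2, which avoids a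
   square root in the hypothesis on [cos al]. *)
have nxe : enorm x <= enorm e.
  rewrite -(@ler_pXn2r _ 2) ?nnegrE ?enorm_ge0 // !enorm_sqr xxE.
  by rewrite gerDl oppr_le0 divr_ge0 ?sqr_ge0 ?dotp_ge0.
apply: le_trans xx_ge; rewrite ler_pM2l // -enorm_sqr expr2.
by rewrite ler_wpM2l ?enorm_ge0.
Qed.
End Euclid.

(** * Flat nearly k-distance sets *)

(** [nearly_kdist] asks for exactly k strictly increasing distances, whereas given bands may
    coincide or be fewer than k. The sorted list without repetitions is padded by values above all
    its members. *)
Lemma increasing_enum (k : nat) (s : seq R) :
  (size s <= k)%N -> {in s, forall x, 1 <= x} ->
  exists t : 'I_k -> R, [/\ forall i, 1 <= t i,
    forall i j : 'I_k, (i < j)%N -> t i < t j & {in s, forall x, exists i, t i = x}].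
Proof.
move=> sk s1; pose s' := sort <=%R (undup s).
have ss' : s' =i s by move=> x; rewrite mem_sort mem_undup.
have sz : (size s' <= k)%N by rewrite size_sort (leq_trans (size_undup s)).
have srt : sorted <%R s' by rewrite sort_lt_sorted undup_uniq.
pose b := 1 + \sum_(x <- s) `|x|.
have b1 : 1 <= b by rewrite lerDl sumr_ge0.
have sb : {in s, forall x, x <= b}.
  move=> x xs; apply: le_trans (ler_norm x) _.
  rewrite /b (big_rem x xs) /= addrCA lerDl addr_ge0 // sumr_ge0 //.
exists (fun i => if (i < size s')%N then nth 0 s' i else b + i%:R); split.
- move=> i; case: ifPn => [lti|_]; first by apply: s1; rewrite -ss' mem_nth.
  by rewrite (le_trans b1) // lerDl.
- move=> i j ij; case: ifPn => [lti|]; last first.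
    rewrite -leqNgt => gei; rewrite ltnNge (leq_trans gei (ltnW ij)) /=.
    by rewrite ltrD2l ltr_nat.
  case: ifPn => [ltj|_].
    by rewrite (lt_sorted_ltn_nth 0 srt).
  have /sb le_b : nth 0 s' i \in s by rewrite -ss' mem_nth.
  by apply: le_lt_trans le_b _; rewrite ltrDl ltr0n (leq_ltn_trans _ ij).
- move=> x; rewrite -ss' => xs; have lt_x : (index x s' < k)%N.
    by apply: leq_trans sz; rewrite index_mem.
  by exists (Ordinal lt_x); rewrite /= index_mem xs nth_index.
Qed.

(** Since 2<e,z> = |e|^2 - |e-z|^2 + |z|^2, its absolute value is at most 2w|e| + w^2 + |z|^2, and
    each of w|e|, w^2 and |z|^2 is at most |e||z|/K. *)
Lemma dotp_near_perp (d : nat) (e z : 'rV[R]_d) (K w : R) :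
  1 <= K -> 0 < w -> K * w <= enorm z -> K * w <= enorm e ->
  K * enorm z <= enorm e -> `|enorm e - enorm (e - z)| <= w ->
  `|dotp e z| <= 2 / K * (enorm e * enorm z).
Proof.
move=> K1 w0 zw ew ze; rewrite ler_norml => /andP[h1 h2].
have K0 : 0 < K by lra.
have := enorm_sqr (e - z); rewrite !dotpE (dotpC z e) -!enorm_sqr.
have : 0 <= enorm (e - z) by exact: enorm_ge0.
have : 0 <= enorm z by exact: enorm_ge0.
have : 0 <= enorm e by exact: enorm_ge0.
move: zw ew ze h1 h2; move: (enorm z) (enorm e) (enorm (e - z)) (dotp e z) => Z E F D.
move=> zw ew ze h1 h2 E0 Z0 F0 FE.
rewrite mulrAC ler_pdivlMr // -[X in _ * X](gtr0_norm K0) -normrM.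
have wE : K * w * E <= Z * E by rewrite ler_wpM2r.
have ZZ : K * Z * Z <= E * Z by rewrite ler_wpM2r.
have ww : K * w * w <= Z * E.
  apply: le_trans wE; rewrite ler_wpM2l ?mulr_ge0 ?(ltW K0) ?(ltW w0) //.
  by apply: le_trans ew; rewrite ler_peMl // ltW.
have F2 : K * F ^+ 2 <= K * (E + w) ^+ 2.
  by rewrite ler_pM2l // ler_pXn2r ?nnegrE //; lra.
have F2' : K * (E - w) ^+ 2 <= K * F ^+ 2.
  rewrite ler_pM2l // ler_pXn2r ?nnegrE //; first lra.
  by rewrite subr_ge0; apply: le_trans ew; rewrite ler_peMl // ltW.
rewrite FE in F2 F2'.
have KZZ : 0 <= K * Z * Z by rewrite -mulrA mulr_ge0 ?mulr_ge0 // ltW.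
have Kww : 0 <= K * w * w by rewrite !mulr_ge0 // ltW.
have ZE0 : 0 <= Z * E by rewrite mulr_ge0.
by rewrite ler_norml; apply/andP; split; lra.
Qed.

(* Each [q a] comes with a partner [z] whose distance to it is large against the
   band width w and small against the clique; [q a - z] is the normal direction. *)
Lemma flat_nearly_kdist (d k m : nat) (eps al : R) : 0 < eps -> 0 < al ->
  exists2 K : R, 2 <= K & forall (w : R) (q : 'I_m -> 'rV[R]_d) (t : 'I_k -> R),
    0 < w ->
    (forall a b, a != b -> K * w <= edist (q a) (q b) /\
      exists i, t i <= edist (q a) (q b) <= t i + w) ->
    (forall a, exists2 z, K * w <= edist (q a) z & forall b, b != a ->
      K * edist (q a) z <= edist (q a) (q b) /\
      `|edist (q a) (q b) - edist z (q b)| <= w) ->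
    exists p : 'I_m -> 'rV[R]_d, flat al p /\ nearly_kdist k eps p.
Proof.
move=> eps0 al0.
(* Capped at [pi], where the cosine is still decreasing. *)
pose al' := Num.min al pi.
have al'_gt0 : 0 < al' by rewrite lt_min al0 pi_gt0.
have al'_le : 0 <= al' <= pi by rewrite (ltW al'_gt0) ge_min lexx orbT.
(* As sg < 1, sg^2 <= sg <= 1 - cos al', which is what [angle_plane_le] needs. *)
pose sg := Num.min (1 / 2) (1 - cos al').
have cos1 : cos al' < 1.
  rewrite -cos0 ltr_cos // in_itv //= ?lexx ?pi_ge0 //.
have sg0 : 0 < sg by rewrite lt_min subr_gt0 cos1 divr_gt0.
have sg_half : sg <= 1 / 2 by rewrite ge_min lexx.
have sg_cos : sg <= 1 - cos al' by rewrite ge_min lexx orbT.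
have sgi : 0 < sg^-1 by rewrite invr_gt0.
have epsi : 0 < eps^-1 by rewrite invr_gt0.
(* The term 2/sg yields 2/K <= sg; the other two yield eps (K - 1) >= 1, so that rescaling by eps/w
   takes (K - 1) w to at least 1. *)
exists (2 + 2 / sg + eps^-1); first lra.
set K := 2 + _ + _ => w q t w0 dist_q near_q.
have K0 : 0 < K by rewrite /K; lra.
have Ksg : 2 / K <= sg.
  rewrite ler_pdivrMr // -ler_pdivrMl // mulrC /K; lra.
have Keps : 1 <= eps * (K - 1).
  have : eps * (K - 1) = eps * (1 + 2 / sg) + 1.
    by rewrite /K; field; rewrite !gt_eqF.
  by move=> ->; rewrite lerDr mulr_ge0 ?ltW //; lra.
have Keps' : 1 <= eps * K by apply: le_trans Keps _; rewrite ler_pM2l //; lra.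
pose la := eps / w.
have la0 : 0 < la by rewrite divr_gt0.
have law : la * w = eps by rewrite divfK ?gt_eqF.
exists (fun a => la *: q a); split.
  move=> a; have [z qz hz] := near_q a.
  pose v := q a - z.
  have v0 : v != 0 by rewrite -enorm_gt0; apply: lt_le_trans qz; rewrite mulr_gt0.
  exists [set x | dotp v x = 0]%classic; split; first by exists v, 0.
  move=> b ba; have [zb diff] := hz _ ba.
  have [ab _] := dist_q _ _ (contra_neq esym ba).
  rewrite -scalerBr; set e := q a - q b.
  have e0 : e != 0 by rewrite -enorm_gt0; apply: lt_le_trans ab; rewrite mulr_gt0.
  apply: (@le_trans _ _ al'); last by rewrite ge_min lexx.
  apply: (@angle_plane_le _ _ _ _ sg) => //.
  - by rewrite scaler_eq0 negb_or e0 gt_eqF.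
  - by rewrite (ltW sg0) /=; lra.
  - have : sg ^+ 2 <= sg by rewrite expr2 ler_piMr ?(ltW sg0) //; lra.
    lra.
  rewrite dotpZl enormZ ?(ltW la0) // normrM (gtr0_norm la0).
  have -> : sg * (la * enorm e * enorm v) = la * (sg * (enorm e * enorm v)) by ring.
  rewrite ler_pM2l //.
  apply: le_trans (_ : 2 / K * (enorm e * enorm v) <= _); last first.
    by rewrite ler_wpM2r // mulr_ge0 ?enorm_ge0.
  apply: (@dotp_near_perp _ _ _ _ w) => //; first by rewrite /K; lra.
  have -> : e - v = z - q b by rewrite /e /v opprB addrC addrA subrK.
  exact: diff.
have band a b : a != b ->
    exists2 i, t i <= edist (q a) (q b) <= t i + w & (K - 1) * w <= t i.
  move=> /dist_q[Kw [i ti]]; exists i => //; rewrite mulrBl mul1r lerBlDr.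
  by apply: le_trans Kw _; case/andP: ti.
split.
  move=> a b /dist_q[Kw _]; rewrite edistZ ?(ltW la0) //.
  apply: le_trans Keps' _; rewrite -law -mulrA ler_pM2l //.
  by rewrite mulrC.
(* Bands starting below 1 after rescaling are dropped. By [band], every pair lies in a band that is
   kept. *)
pose s := [seq la * t i | i <- enum 'I_k & 1 <= la * t i].
have sk : (size s <= k)%N.
  by rewrite size_map size_filter (leq_trans (count_size _ _)) // size_enum_ord.
have [|t' [t'1 t'incr t's]] := increasing_enum sk.
  by move=> x /mapP[i]; rewrite mem_filter => /andP[? _] ->.
exists t'; split=> //; split=> // a b ab.
have [i /andP[t1 t2] Kt] := band a b ab.
have [|j tj] := t's (la * t i).
  apply/map_f; rewrite mem_filter mem_enum andbT.
  apply: le_trans Keps _; rewrite -law -mulrA ler_pM2l // mulrC //.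
exists j; rewrite tj edistZ ?(ltW la0) // -law -mulrDr !ler_pM2l //.
by rewrite t1.
Qed.

(** * The distance graph *)

(* The set inside count_pairs is a classical set, not a finset. *)
Lemma count_pairsE (d n k : nat) (p : 'I_n -> 'rV[R]_d) (t : 'I_k -> R) (w : R) :
  count_pairs p t w = #|[set ab : 'I_n * 'I_n | (ab.1 < ab.2)%N &&
     [exists i : 'I_k, (t i <= edist (p ab.1) (p ab.2))
                        && (edist (p ab.1) (p ab.2) <= t i + w)]]|.
Proof. by apply: eq_card => ab; rewrite !inE; apply/idP/idP; rewrite in_setE. Qed.

Section DistanceGraph.
Variables (d n k : nat) (p : 'I_n -> 'rV[R]_d) (t : 'I_k -> R) (w K : R).
Hypotheses (d_gt0 : (0 < d)%N) (p_sep : separated p).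
Hypotheses (w_gt0 : 0 < w) (K_ge2 : 2 <= K).

Definition in_band (i : 'I_k) (a b : 'I_n) : bool :=
  (t i <= edist (p a) (p b)) && (edist (p a) (p b) <= t i + w).

Definition long_edge : rel 'I_n := fun a b =>
  (K * w <= edist (p a) (p b)) && [exists i, in_band i a b].

(** Packing bound for a ball of radius K w: the number of grid cells of diameter less than 1, each
    holding at most one point. *)
Definition ball_bound : nat := ((Num.truncn (2 * d%:R * (K * w))).+1 ^ d)%N.

Let K_gt0 : 0 < K. Proof. exact: lt_le_trans K_ge2. Qed.
Let Kw_gt0 : 0 < K * w. Proof. exact: mulr_gt0. Qed.

Lemma long_edge_sym : symmetric long_edge.
Proof.
move=> a b; rewrite /long_edge edistC; congr andb.
by apply: eq_existsb => i; rewrite /in_band edistC.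
Qed.

Lemma long_edge_irr : irreflexive long_edge.
Proof. by move=> a; rewrite /long_edge edistxx leNgt Kw_gt0. Qed.

Lemma card_near (S : {set 'I_n}) (y : 'rV[R]_d) :
  {in S, forall a, edist (p a) y <= K * w} -> (#|S| <= ball_bound)%N.
Proof.
move=> Sy; rewrite /ball_bound -[(_ ^ d)%N]muln1.
have := @card_ball_le _ _ p S y (K * w) 1 1 d_gt0 ltr01 (ltW Kw_gt0) Sy.
rewrite divr1; apply => T _ T1; rewrite leqNgt.
apply/negP => /card_gt1P[a [b [aT bT ab]]].
by have := lt_le_trans (T1 a b aT bT) (p_sep ab); rewrite ltxx.
Qed.

(** A pair in a band that is no long edge is shorter than K w, and each point has at most
    [ball_bound] points that near. The factor 2 passes from unordered to ordered pairs. *)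
Lemma card_long_edge :
  (2 * count_pairs p t w <=
     #|[set ab : 'I_n * 'I_n | long_edge ab.1 ab.2]| + 2 * (n * ball_bound))%N.
Proof.
pose E := [set ab : 'I_n * 'I_n | long_edge ab.1 ab.2].
pose up := [set ab : 'I_n * 'I_n | (ab.1 < ab.2)%N].
pose near := [set ab : 'I_n * 'I_n | edist (p ab.1) (p ab.2) < K * w].
have card_near_pairs : (#|near| <= n * ball_bound)%N.
  rewrite -[X in (X * _)%N](card_ord n); apply: (@card_fibers _ _ (fun ab => ab.2)) => b.
  have -> : #|[set ab in near | ab.2 == b]| = #|[set a | edist (p a) (p b) < K * w]|.
    rewrite -[RHS](card_imset _ (_ : injective (fun a : 'I_n => (a, b)))); last by move=> ? ? [].
    apply: eq_card => -[a c]; rewrite !inE /=.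
    apply/andP/imsetP => [[/[swap] /eqP-> ab]|[a']]; first by exists a => //; rewrite inE.
    by rewrite inE => ab [-> ->].
  by apply: (@card_near _ (p b)) => a; rewrite inE => /ltW.
have cpE : (count_pairs p t w <= #|E :&: up| + #|near|)%N.
  rewrite count_pairsE; apply: leq_trans (leq_card_setU _ _); apply: subset_leq_card.
  apply/fintype.subsetP => -[a b]; rewrite !inE /= => /andP[ab band].
  by rewrite ab andbT /long_edge band andbT leNgt; case: ltP.
have upE : (2 * #|E :&: up| <= #|E|)%N.
  rewrite mul2n -addnn -(cardsID up E) leq_add2l.
  rewrite -(card_imset _ (_ : injective (fun ab : 'I_n * 'I_n => (ab.2, ab.1)))); last first.
    by move=> [? ?] [? ?] [-> ->].
  apply: subset_leq_card; apply/fintype.subsetP => _ /imsetP[[a b] + ->].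
  by rewrite !inE /= long_edge_sym -leqNgt => /andP[-> /ltnW ->].
apply: leq_trans (leq_add upE (leq_mul (leqnn 2) card_near_pairs)).
by rewrite -mulnDr leq_mul2l.
Qed.

(* The v' excluded here would make [p v - p v'] a normal direction at v. *)
Definition unpaired (L : {set 'I_n}) : {set 'I_n} :=
  [set v in nbrs long_edge L | ~~ [exists v' : 'I_n,
     (K * w <= edist (p v) (p v')) && [forall u in L,
       (K * edist (p v) (p v') <= edist (p v) (p u)) &&
       (`|edist (p v) (p u) - edist (p v') (p u)| <= w)]]].

Lemma card_unpaired (N : nat) (L : {set 'I_n}) :
  (0 < N)%N -> (0 < k)%N -> #|L| = N ->
  (#|unpaired L| <=
     k ^ N * ((Num.truncn (4 * d%:R * K)).+1 ^ d * ball_bound))%N.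
Proof.
move=> N0 k0 cL.
have [x0 x0L] : exists x0, x0 \in L by apply/card_gt0P; rewrite cL.
have szL : size (enum L) = N by rewrite -cardE.
pose u (j : 'I_N) := nth x0 (enum L) j.
have uL j : u j \in L by rewrite -mem_enum mem_nth // szL.
have uP y : y \in L -> exists j, u j = y.
  move=> yL; have lt_y : (index y (enum L) < N)%N by rewrite -szL index_mem mem_enum.
  by exists (Ordinal lt_y); rewrite /u /= nth_index ?mem_enum.
(* The class of [v] is its tuple of bands towards [L]. The default never occurs on unpaired
   vertices, which are adjacent to all of [L]. *)
pose col v := [ffun j => odflt (Ordinal k0) [pick i | in_band i v (u j)]].
have colP v j : v \in unpaired L -> in_band (col v j) v (u j).
  rewrite inE => /andP[/nbrsP/(_ _ (uL j))/andP[_ /existsP[i iv]] _].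
  by rewrite ffunE; case: pickP => [//|/(_ i)]; rewrite iv.
have -> : (k ^ N = #|{ffun 'I_N -> 'I_k}|)%N by rewrite card_ffun !card_ord.
apply: (@card_fibers _ _ col) => c.
set S := [set v in _ | _].
have [->|[v0 v0S]] := set_0Vmem S; first by rewrite cards0.
have SP v : v \in S -> v \in unpaired L /\ forall j, in_band (c j) v (u j).
  by rewrite inE => /andP[vU /eqP cv]; split=> // j; rewrite -cv colP.
have [j0 _ j0_min] := @arg_minP _ _ _ (Ordinal N0) xpredT (fun j => t (c j)) isT.
set t0 := t (c j0) in j0_min.
(* From 2w <= K w <= |v0 u| <= t0 + w for the vertex [u j0]; hence the class lies within t0 + w <= 2
   t0 of it. *)
have wt0 : w <= t0.
  have [+ /(_ j0)/andP[_ hi]] := SP _ v0S.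
  rewrite inE => /andP[/nbrsP/(_ _ (uL j0))/andP[lo _] _].
  have : 2 * w <= K * w by rewrite ler_pM2r.
  move: (le_trans lo hi); rewrite -/t0; lra.
have t0_gt0 : 0 < t0 by apply: lt_le_trans wt0.
(* Radius 2 t0 against cell diameter t0/K: the number of cells does not depend on t0. *)
have -> : 4 * d%:R * K = 2 * d%:R * (2 * t0) / (t0 / K).
  by field; rewrite !gt_eqF.
apply: (@card_ball_le _ _ p S (p (u j0))) => //.
- exact: divr_gt0.
- by rewrite mulr_ge0 // ltW.
- move=> v /SP[_ /(_ j0)/andP[_ hi]]; apply: le_trans hi _.
  by rewrite -/t0; lra.
move=> T /fintype.subsetP TS T_close.
have [->|[v1 v1T]] := set_0Vmem T; first by rewrite cards0.
(* A member [v] farther than K w from [v1] would be a partner of [v1]: K |v1 v| <= t0 by the cell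
   size, t0 is below every distance to [L], and equal bands make the distances differ by at most
   w. *)
apply: (@card_near _ (p v1)) => v vT; rewrite leNgt; apply/negP => far.
have [v1U v1c] := SP _ (TS _ v1T).
have [_ vc] := SP _ (TS _ vT).
move: v1U; rewrite inE => /andP[_ /existsP]; apply; exists v.
rewrite edistC (ltW far) /=; apply/forall_inP => y /uP[j <-].
have /andP[lo1 hi1] := v1c j; have /andP[lo hi] := vc j.
apply/andP; split; last by rewrite ler_norml; lra.
apply: le_trans lo1; apply: le_trans (j0_min j isT); rewrite -/t0.
rewrite mulrC -ler_pdivlMr //; exact/ltW/T_close.
Qed.

End DistanceGraph.

(** * Choice of constants and the bound on the number of pairs *)

Lemma M_attained_le (d k n M : nat) (w w' : R) : w <= w' ->
  M_attained d k n w M -> M_attained d k n w' M.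
Proof.
move=> ww' [p [t [sep [adm Mle]]]]; exists p, t; split=> //; split=> //.
apply: leq_trans Mle _; rewrite !count_pairsE.
apply: subset_leq_card; apply/fintype.subsetP => ab.
rewrite !inE => /andP[-> /existsP[i /andP[lo hi]]]; apply/existsP; exists i.
by rewrite lo (le_trans hi) // lerD2l.
Qed.

(** Counted pairs and their transposes are disjoint in the n^2 ordered pairs. This settles N = 0,
    where [N%:R^-1] is 0 and the claimed coefficient exceeds 1. *)
Lemma M_attained_le_pairs (d k n M : nat) (w : R) : M_attained d k n w M ->
  M%:R <= n%:R ^+ 2 / 2 :> R.
Proof.
move=> [p [t [_ [_ Mle]]]].
rewrite ler_pdivlMr // -natrX -natrM ler_nat.
apply: leq_trans (leq_mul Mle (leqnn 2)) _.
rewrite count_pairsE; set P := [set ab | _].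
rewrite muln2 -addnn.
have dis : [disjoint P & [set (ab.2, ab.1) | ab in P]].
  rewrite finset.disjoints_subset; apply/fintype.subsetP => -[a b].
  rewrite !inE /= => /andP[ab _]; apply/imsetP => -[[a' b']]; rewrite inE /= => /andP[ba _] [ea eb].
  by move: ab; rewrite ea eb ltnNge ltnW.
have inj : injective (fun ab : 'I_n * 'I_n => (ab.2, ab.1)).
  by move=> [? ?] [? ?] [-> ->].
rewrite -{2}(card_imset (mem P) inj).
have := dis; rewrite -leq_card_setU => /eqP <-.
by apply: leq_trans (max_card _) _; rewrite card_prod card_ord mulnn.
Qed.

(* Radius-[K w] balls contain at most [eta n] points by the choice of c, so deleting
   the short edges and discarding unpaired vertices are both negligible. *)
Lemma wide_bands_bound (d k N : nat) (gamma : R) :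
  (0 < d)%N -> (0 < k)%N -> (0 < N)%N -> 0 < gamma -> ~ N_prop d k N.+1 ->
  exists2 c : R, 0 < c & exists n0 : nat, forall n : nat, (n0 <= n)%N ->
    1 <= c * powR n%:R d%:R^-1 /\ forall M : nat,
     M_attained d k n (c * powR n%:R d%:R^-1) M ->
       M%:R <= (1 - N%:R^-1 + gamma) * (n%:R ^+ 2 / 2).
Proof.
move=> d0 k0 N0 gamma0 notN.
have [eps [al [eps0 [al0 no_config]]]] : exists eps al : R, 0 < eps /\ 0 < al /\
    ~ exists p : 'I_N.+1 -> 'rV[R]_d, flat al p /\ nearly_kdist k eps p.
  apply: contrapT => H; apply: notN => eps al eps0 al0; apply: contrapT => H'.
  by apply: H; exists eps, al.
have [K K2 config] := @flat_nearly_kdist d k N.+1 eps al eps0 al0.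
have K0 : 0 < K by apply: lt_le_trans K2.
pose C := (k ^ N * (Num.truncn (4 * d%:R * K)).+1 ^ d)%N.
have C0 : (0 < C)%N by rewrite muln_gt0 !expn_gt0 k0.
have C1 : 1 <= C%:R :> R by rewrite ler1n.
(* The fraction of points allowed in a ball of radius K w. The bound 1 gives eta^d <= eta; the other
   keeps C eta <= gamma/8. *)
pose eta := Num.min 1 (gamma / (8 * C%:R)) : R.
have eta0 : 0 < eta by rewrite lt_min ltr01 divr_gt0 // mulr_gt0 // ltr0n.
have eta1 : eta <= 1 by rewrite ge_min lexx.
have Ceta : C%:R * eta <= gamma / 8.
  have : eta <= gamma / (8 * C%:R) by rewrite ge_min lexx orbT.
  rewrite -(ler_pM2l (_ : 0 < C%:R)) ?ltr0n // => /le_trans; apply.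
  by rewrite le_eqVlt; apply/orP; left; apply/eqP; field; rewrite pnatr_eq0 -lt0n.
have dR : 0 < d%:R :> R by rewrite ltr0n.
have dR1 : 1 <= d%:R :> R by rewrite ler1n.
(* Then 3 d K w = eta n^(1/d), so [ball_bound] is at most (2 d K w + 1)^d <= (3 d K w)^d = eta^d
   n. *)
pose c := eta / (3 * d%:R * K).
have c0 : 0 < c by rewrite divr_gt0 // !mulr_gt0.
(* This makes w^d = c^d n at least 1, hence w >= 1. *)
exists c => //; exists (Num.truncn (c ^- d)).+1 => n n_ge.
have n0 : (0 < n)%N by apply: leq_trans n_ge.
have nR : 0 < n%:R :> R by rewrite ltr0n.
set w := c * _.
have w0 : 0 < w by rewrite mulr_gt0 // powR_gt0.
have wd : w ^+ d = c ^+ d * n%:R.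
  rewrite exprMn; congr (_ * _).
  by rewrite -powR_mulrn ?powR_ge0 // -powRrM mulVf ?gt_eqF // powRr1 // ltW.
have w1 : 1 <= w.
  rewrite leNgt; apply/negP => w1.
  have : w ^+ d < 1 by rewrite exprn_ilt1 ?(ltW w0) // -lt0n.
  rewrite wd; apply/negP; rewrite -leNgt -ler_pdivrMl ?exprn_gt0 // mulr1.
  apply: ltW; apply: lt_le_trans (truncnS_gt _) _; by rewrite ler_nat.
split=> // M [p [t [sep [_ Mle]]]].
have B_le : (ball_bound d w K)%:R <= eta * n%:R :> R.
  rewrite natrX; apply: le_trans (_ : (3 * d%:R * K * w) ^+ d <= _).
    apply: lerXn2r; rewrite ?nnegrE ?ler0n //.
      by apply/ltW/mulr_gt0 => //; rewrite mulr_gt0 // mulr_gt0.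
    have h1 : 1 <= d%:R * (K * w).
      by apply: mulr_ege1 => //; apply: mulr_ege1 => //; lra.
    have h0 : 0 <= 2 * d%:R * (K * w) by rewrite -mulrA mulr_ge0 // (le_trans ler01).
    have /andP[tr _] := truncn_itv h0.
    rewrite -natr1; apply: le_trans (lerD tr h1) _.
    by rewrite le_eqVlt; apply/orP; left; apply/eqP; ring.
  rewrite exprMn wd mulrA -exprMn /c mulrC [3 * _ * _ * _]mulrC divfK; last first.
    by rewrite gt_eqF // !mulr_gt0.
  rewrite mulrC ler_pM2r // -[leRHS]expr1.
  by rewrite ler_wiXn2l // ltW.
rewrite leNgt; apply/negP => M_gt.
have sym := long_edge_sym p t w K.
have irr := long_edge_irr p t w0 K2.
(* Short pairs cost at most 2 eta n^2 <= (gamma/4) n^2 ordered pairs, so an excess of gamma/2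
   survives. The unpaired vertices fit because (N+1) gamma/8 < N gamma/2. *)
have := @clique_avoiding _ _ sym irr R N (gamma / 2) (C%:R * (eta * n%:R))
  (unpaired p t w K).
rewrite card_ord => /(_ n0 N0) [||L LN||L LN Lgood].
- lra.
- have := card_long_edge t d0 sep w0 K2; rewrite -(ler_nat R) natrD !natrM => hE.
  have hM : 2 * M%:R <= 2 * (count_pairs p t w)%:R :> R by rewrite ler_pM2l // ler_nat.
  have hB : n%:R * (ball_bound d w K)%:R <= n%:R * (eta * n%:R) :> R by rewrite ler_pM2l.
  have he : eta <= gamma / 8.
    by apply: le_trans Ceta; rewrite ler_peMl // ltW.
  have hen : eta * (n%:R * n%:R) <= gamma / 8 * (n%:R * n%:R) by rewrite ler_pM2r ?mulr_gt0.
  have gn : 0 <= gamma * (n%:R * n%:R) by rewrite !mulr_ge0 // ltW.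
  move: M_gt hE hM hB hen gn; move: (N%:R^-1) => iN.
  move: (n%:R) (M%:R) => nn MM; rewrite expr2.
  lra.
- split; first by apply/fintype.subsetP => v; rewrite inE => /andP[].
  have [cL _] := cliquesP _ _ _ LN.
  have := card_unpaired t d0 sep w0 K2 N0 k0 cL.
  rewrite mulnA -/C -(ler_nat R) natrM => /le_trans; apply.
  by rewrite ler_wpM2l // ler0n.
- have N1 : 1 <= N%:R :> R by rewrite ler1n.
  rewrite !mulrA ltr_pM2r // -[ltLHS]mulrA -natr1.
  apply: le_lt_trans (_ : (N%:R + 1) * (gamma / 8) < _); first by rewrite ler_pM2l //; lra.
  have : gamma <= N%:R * gamma by rewrite ler_peMl // ltW.
  have : 0 < N%:R * gamma by rewrite mulr_gt0 // (lt_le_trans ltr01).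
  lra.
apply: no_config.
have [cL aL] := cliquesP _ _ _ LN.
have [x0 _] : exists x0, x0 \in L by apply/card_gt0P; rewrite cL.
have szL : size (enum L) = N.+1 by rewrite -cardE.
pose u (j : 'I_N.+1) := nth x0 (enum L) j.
have uL j : u j \in L by rewrite -mem_enum mem_nth // szL.
have u_neq a b : a != b -> u a != u b.
  by rewrite /u nth_uniq ?szL // enum_uniq.
apply: (config w (p \o u) t w0) => [a b ab|a] /=.
  have /andP[Kw /existsP[i band]] := aL _ _ (uL a) (uL b) (u_neq _ _ ab).
  by split=> //; exists i.
have := Lgood _ (uL a); rewrite inE negb_and negbK => /orP[/negP[]|].
  apply/nbrsP => y; rewrite !inE => /andP[ya yL]; apply: aL => //.
  by rewrite eq_sym.
case/existsP => v' /andP[Kw /forall_inP near]; exists (p v') => // b ba.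
by apply/andP; apply: near; rewrite !inE uL u_neq.
Qed.

Theorem theorem9 (d k : nat) (gamma : R) (N : nat) :
  (2 <= d)%N -> (1 <= k)%N -> 0 < gamma -> is_Nk d k N ->
  (exists n0 : nat, forall n : nat, (n0 <= n)%N ->
     forall M : nat, M_attained d k n 1 M ->
       M%:R <= (1 - N%:R^-1 + gamma) * (n%:R ^+ 2 / 2))
  /\
  (exists c : R, 0 < c /\ exists n0 : nat, forall n : nat, (n0 <= n)%N ->
     forall M : nat, M_attained d k n (c * powR n%:R d%:R^-1) M ->
       M%:R <= (1 - N%:R^-1 + gamma) * (n%:R ^+ 2 / 2)).
Proof.
move=> d2 k0 gamma0 [_ N_max].
have [N0|N0] := posnP N.
  have triv n w M : M_attained d k n w M ->
      M%:R <= (1 - N%:R^-1 + gamma) * (n%:R ^+ 2 / 2).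
    move=> /M_attained_le_pairs /le_trans; apply.
    rewrite N0 invr0 subr0 ler_peMl ?divr_ge0 ?sqr_ge0 //; lra.
  split; first by exists 0%N => n _ M; exact: triv.
  by exists 1; split=> //; exists 0%N => n _ M; exact: triv.
have notN : ~ N_prop d k N.+1 by move=> /N_max; rewrite ltnn.
have [c c0 [n0 H]] := wide_bands_bound (ltnW d2) k0 N0 gamma0 notN.
split; last by exists c; split=> //; exists n0 => n /H[].
(* For n >= n0 the wide bands have width at least 1, so they contain the unit bands. *)
exists n0 => n /H[w1 HM] M HM1; apply: HM; exact: M_attained_le HM1.
Qed.
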